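(* Let $f:\mathbb{R}^d\to\mathbb{R}$ be an $L$-smooth function with $L>0$ (not assumed convex), bounded below, and let $f_*=\inf_{x}f(x)$. Suppose the stochastic gradient satisfies $\mathbb{E}[\mathcal G(x;\xi)]=\nabla f(x)$ and $\mathbb{E}[\|\mathcal G(x;\xi)-\nabla f(x)\|^2]\le\sigma^2$ for every $x\in\mathbb{R}^d$, and that $\|\nabla f(x)\|\le G$ for every $x\in\mathbb{R}^d$. Let $\beta\in[0,1)$, $s\ge 0$, $C>0$, let $t\ge 0$ be an integer, and run the stochastic unified momentum (SUM) method from $x_0\in\mathbb{R}^d$ for $t$ iterations with stochastic gradients $\mathcal G(x_k;\xi_k)$ and step size $\alpha=\min\left\{\frac{1-\beta}{2L},\frac{C}{\sqrt{t+1}}\right\}$. Then $$\min_{k=0,\ldots,t}\mathbb{E}[\|\nabla f(x_k)\|^2]\le \frac{2(f(x_0)-f_* )(1-\beta)}{t+1}\max\left\{\frac{2L}{1-\beta},\frac{\sqrt{t+1}}{C}\right\}+\frac{C}{\sqrt{t+1}}\cdot\frac{L\beta^2((1-\beta)s-1)^2(G^2+\sigma^2)+L\sigma^2(1-\beta)^2}{(1-\beta)^3}.$$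
   Context: $\|\cdot\|$ is the Euclidean norm. A differentiable function $f$ is $L$-smooth if $\|\nabla f(y)-\nabla f(x)\|\le L\|y-x\|$ for all $x,y\in\mathbb{R}^d$. $\mathcal G(x;\xi)\in\mathbb{R}^d$ is a stochastic gradient of $f$ at $x$ depending on a random variable $\xi$. The random variables $\xi_0,\xi_1,\dots$ are independent copies of $\xi$, so that $x_k$ depends only on $\xi_0,\dots,\xi_{k-1}$ and the moment conditions on $\mathcal G$ hold conditionally at $x_k$. The starting point $x_0$ is deterministic. The SUM method with parameters $\alpha>0$, $\beta\in[0,1)$, $s\ge0$ and starting point $x_0$ is: set $y^s_0=x_0$ and for $k\ge 0$ $$y_{k+1}=x_k-\alpha\,\mathcal G(x_k;\xi_k),\qquad y^s_{k+1}=x_k-s\alpha\,\mathcal G(x_k;\xi_k),\qquad x_{k+1}=y_{k+1}+\beta\,(y^s_{k+1}-y^s_k).$$ *)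

(* Defs.v *)
From HB Require Import structures.
From mathcomp Require Import all_boot all_order all_algebra finmap.
From mathcomp Require Import all_classical all_reals all_analysis.

Set Implicit Arguments.
Unset Strict Implicit.
Unset Printing Implicit Defensive.

Import Order.TTheory GRing.Theory Num.Theory.
Import numFieldNormedType.Exports.

Local Open Scope classical_set_scope.
Local Open Scope ring_scope.

(* The library's norm on matrices is the sup norm, hence this definition.     *)
Definition enorm (R : realType) (d : nat) (x : 'rV[R]_d) : R :=
  Num.sqrt (\sum_(i < d) x 0 i ^+ 2).

Definition gradient (R : realType) (d : nat) (f : 'rV[R]_d -> R)
    (x : 'rV[R]_d) : 'rV[R]_d :=
  \row_(i < d) 'D_(delta_mx 0 i) f x.

(* Differentiability is Frechet differentiability for the sup norm; by        *)
(* equivalence of norms in finite dimension this is the usual notion.         *)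
Definition smooth (R : realType) (d : nat) (L : R) (f : 'rV[R]_d -> R) : Prop :=
  (forall x, differentiable f x) /\
  (forall x y, enorm (gradient f y - gradient f x) <= L * enorm (y - x)).

Definition borel_rV (R : realType) (d : nat) :=
  g_sigma_algebraType (@open 'rV[R]_d).

Definition mutually_independent (d1 d2 : measure_display)
    (Omega : measurableType d1) (Xi : measurableType d2) (R : realType)
    (P : probability Omega R) (X : nat -> {RV P >-> Xi}) : Prop :=
  forall (J : {fset nat}) (A : nat -> set Xi),
    (forall j, measurable (A j)) ->
    P (\bigcap_(j in [set` J]) X j @^-1` A j) =
      (\prod_(j <- J) P (X j @^-1` A j))%E.

Definition same_law (d1 d2 : measure_display)
    (Omega : measurableType d1) (Xi : measurableType d2) (R : realType)
    (P : probability Omega R) (X Y : {RV P >-> Xi}) : Prop :=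
  forall A : set Xi, measurable A -> distribution P X A = distribution P Y A.

(* Joint measurability in (x, xi) is what makes the quantities g (x_k, xi_k)  *)
(* random variables, so that the moment conditions transfer to x_k.           *)
Definition jointly_measurable (d2 : measure_display) (Xi : measurableType d2)
    (R : realType) (d : nat) (g : 'rV[R]_d -> Xi -> 'rV[R]_d) : Prop :=
  measurable_fun [set: (borel_rV R d * Xi)%type]
    (fun p => g p.1 p.2 : borel_rV R d).

(* The expectation is extended-real valued, so the first equation, whose      *)
(* right-hand side is finite, also says that g x xi is integrable.            *)
Definition unbiased (d1 d2 : measure_display)
    (Omega : measurableType d1) (Xi : measurableType d2) (R : realType)
    (P : probability Omega R) (d : nat) (xi : {RV P >-> Xi})
    (g : 'rV[R]_d -> Xi -> 'rV[R]_d) (f : 'rV[R]_d -> R) : Prop :=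
  forall (x : 'rV[R]_d) (i : 'I_d),
    ('E_P[(fun w => g x (xi w) 0 i)%R] = (gradient f x 0 i)%R%:E)%E.

Definition variance_bounded (d1 d2 : measure_display)
    (Omega : measurableType d1) (Xi : measurableType d2) (R : realType)
    (P : probability Omega R) (d : nat) (xi : {RV P >-> Xi})
    (g : 'rV[R]_d -> Xi -> 'rV[R]_d) (f : 'rV[R]_d -> R) (sigma : R) : Prop :=
  forall x : 'rV[R]_d,
    ('E_P[(fun w => enorm (g x (xi w) - gradient f x) ^+ 2)%R]
       <= (sigma ^+ 2)%R%:E)%E.

(* The pair (x_k, y^s_k), along a realization z of the sequence of xi_k.      *)
Fixpoint sum_state (R : realType) (d : nat) (Xi : Type)
    (g : 'rV[R]_d -> Xi -> 'rV[R]_d) (alpha beta s : R) (x0 : 'rV[R]_d)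
    (z : nat -> Xi) (k : nat) : 'rV[R]_d * 'rV[R]_d :=
  if k is k'.+1 then
    let: (x, ys) := sum_state g alpha beta s x0 z k' in
    let y' := x - alpha *: g x (z k') in
    let ys' := x - (s * alpha) *: g x (z k') in
    (y' + beta *: (ys' - ys), ys')
  else (x0, x0).

Definition sum_iter (R : realType) (d : nat) (Xi : Type)
    (g : 'rV[R]_d -> Xi -> 'rV[R]_d) (alpha beta s : R) (x0 : 'rV[R]_d)
    (z : nat -> Xi) (k : nat) : 'rV[R]_d :=
  (sum_state g alpha beta s x0 z k).1.

Definition sum_step (R : realType) (L beta C : R) (t : nat) : R :=
  Num.min ((1 - beta) / (2 * L)) (C / Num.sqrt t.+1%:R).

(* Main.v *)
(* With v_k = x_k - y^s_k, the averaged iterate                               *)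
(*   z_k = x_k + beta / (1 - beta) v_k                                        *)
(* follows a plain stochastic gradient step of size alpha / (1 - beta), with  *)
(* the gradient sampled at x_k, while v_k follows the linear recursion        *)
(*   v_(k+1) = beta v_k + ((1 - beta) s - 1) alpha g(x_k, xi_k),              *)
(* so that E|v_k|^2 stays bounded by convexity of the square.  The descent    *)
(* lemma along z_k, the drift |grad f(z_k) - grad f(x_k)| <= L |z_k - x_k|    *)
(* being absorbed thanks to 2 L alpha <= 1 - beta, gives a recursion for      *)
(* E[f(z_k) - inf f] that telescopes.  All expectations taken along the       *)
(* trajectory are of nonnegative quantities, so Tonelli applies without any   *)
(* integrability check; signed integrals only occur at a fixed point x.       *)

Require Import Defs.
From HB Require Import structures.
From mathcomp Require Import all_boot all_order all_algebra finmap.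
From mathcomp Require Import all_classical all_reals all_analysis.
From mathcomp Require Import measurable_realfun.
From mathcomp Require Import ring lra.

Set Implicit Arguments.
Unset Strict Implicit.
Unset Printing Implicit Defensive.

Import Order.TTheory GRing.Theory Num.Theory.
Import numFieldNormedType.Exports.

Local Open Scope classical_set_scope.
Local Open Scope ring_scope.

(** * Euclidean geometry and the descent lemma *)

(** Averaging removes the momentum: [z_k] moves exactly by [- a g(x_k, xi_k)] with
    [a = alpha / (1 - beta)], so SUM is SGD whose gradient is sampled at a point off by a multiple
    of [v_k]. For frozen [x] and [z], [conditional_descent] yields an expected decrease of
    [a / 2 |grad f(x)|^2], up to the drift [L / 2 |z - x|^2] and a variance term;
    [conditional_momentum] controls the drift, since the momentum contracts by [beta] and is fed by
    gradients of second moment at most [G^2 + sigma^2].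

    To use these bounds along the trajectory, [x_k] and [v_k] are shown measurable for the
    sigma-algebra of the first [k] samples; [integral_past_fresh] then replaces [xi_k] by an
    independent copy with the past frozen, which plays the role of conditional expectation. The
    resulting recursion [expected_descent] telescopes to a bound on the sum of [E |grad f(x_k)|^2].
    The minimum is at most the mean, and [sum_step_bound] inserts the step size. *)

Section Euclidean.
Context {R : realType} {d : nat}.
Implicit Types (u v w : 'rV[R]_d) (a : R).

Definition edot u v : R := \sum_(i < d) u 0 i * v 0 i.

Lemma edotC u v : edot u v = edot v u.
Proof. by apply: eq_bigr => i _; rewrite mulrC. Qed.

Lemma edotDl u v w : edot (u + v) w = edot u w + edot v w.
Proof. by rewrite -big_split; apply: eq_bigr => i _; rewrite mxE mulrDl. Qed.

Lemma edotZl a u w : edot (a *: u) w = a * edot u w.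
Proof. by rewrite /edot mulr_sumr; apply: eq_bigr => i _; rewrite mxE mulrA. Qed.

Lemma edotNl u w : edot (- u) w = - edot u w.
Proof. by rewrite -scaleN1r edotZl mulN1r. Qed.

Lemma edotDr u v w : edot w (u + v) = edot w u + edot w v.
Proof. by rewrite edotC edotDl !(edotC w). Qed.

Lemma edotZr a u w : edot w (a *: u) = a * edot w u.
Proof. by rewrite edotC edotZl (edotC w). Qed.

Lemma edotNr u w : edot w (- u) = - edot w u.
Proof. by rewrite edotC edotNl (edotC w). Qed.

Definition edotE := (edotDl, edotDr, edotZl, edotZr, edotNl, edotNr).

Lemma edot_ge0 u : 0 <= edot u u.
Proof. by apply: sumr_ge0 => i _; rewrite -expr2 sqr_ge0. Qed.

Lemma enorm_sqr u : enorm u ^+ 2 = edot u u.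
Proof.
rewrite /enorm sqr_sqrtr; last by apply: sumr_ge0 => i _; exact: sqr_ge0.
by apply: eq_bigr => i _; rewrite expr2.
Qed.

Lemma enorm_ge0 u : 0 <= enorm u.
Proof. exact: sqrtr_ge0. Qed.

Lemma coord_le_enorm u i : `|u 0 i| <= enorm u.
Proof.
rewrite -sqrtr_sqr ler_wsqrtr// (bigD1 i)//= lerDl.
by apply: sumr_ge0 => j _; exact: sqr_ge0.
Qed.

Lemma enorm_le_sqrt a u : 0 <= a -> (forall i, `|u 0 i| <= a) ->
  enorm u <= Num.sqrt d%:R * a.
Proof.
move=> a0 ua; rewrite -[X in _ * X](ger0_norm a0) -sqrtr_sqr -sqrtrM ?ler0n//.
rewrite ler_wsqrtr// mulr_natl -[d in leRHS]card_ord -sumr_const.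
apply: ler_sum => i _; rewrite -real_normK ?num_real// lerXn2r ?nnegrE//.
Qed.

End Euclidean.

Section Descent.
Context {R : realType} {d : nat} (f : 'rV[R]_d -> R) (L : R).
Hypotheses (L0 : 0 < L) (hf : smooth L f).
Implicit Types x y v : 'rV[R]_d.

(** [gradient] only records partial derivatives; differentiability makes the directional derivative
    linear in [v], so the partials determine it. *)
Lemma derive_gradient x v : 'D_v f x = edot (gradient f x) v.
Proof.
have dfx := hf.1 x.
rewrite deriveE// [in LHS](row_sum_delta v) linear_sum; apply: eq_bigr => i _.
by rewrite linearZ /= mxE deriveE// mulrC.
Qed.

Lemma is_derive_line x v (t : R) :
  is_derive t 1 (fun t : R => f (x + t *: v))
    (edot (gradient f (x + t *: v)) v).
Proof.
have E : (fun h : R =>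
    h^-1 *: (f (x + (h *: (1 : R) + t) *: v) - f (x + t *: v))) =
  (fun h : R => h^-1 *: (f (h *: v + (x + t *: v)) - f (x + t *: v))).
  apply/funext => h; congr (_ *: (f _ - _)).
  by rewrite [h *: 1]mulr1 scalerDl addrCA.
apply: DeriveDef.
- rewrite /derivable /= E.
  exact: (@diff_derivable _ _ _ f (x + t *: v) v (hf.1 _)).
- by rewrite -derive_gradient /derive /= E.
Qed.

Lemma smooth_sqr x y :
  edot (gradient f y - gradient f x) (gradient f y - gradient f x) <=
  L ^+ 2 * edot (y - x) (y - x).
Proof.
rewrite -!enorm_sqr -exprMn lerXn2r ?nnegrE ?mulr_ge0 ?enorm_ge0 ?(ltW L0)//.
exact: hf.2.
Qed.

Lemma descent x v :
  f (x + v) <= f x + edot (gradient f x) v + L / 2 * edot v v.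
Proof.
(* The claim is [psi 1 <= psi 0]; by the mean value theorem it suffices that [psi] has nonpositive
   derivative on the open unit interval, so no integral along the segment occurs. *)
pose psi t := f (x + t *: v) - t * edot (gradient f x) v
   - t ^+ 2 * (L / 2 * edot v v).
pose dpsi t := edot (gradient f (x + t *: v)) v - edot (gradient f x) v
   - t * (L * edot v v).
have dp (t : R) : is_derive t (1 : R) psi (dpsi t).
  have := is_derive_line x v t => H.
  rewrite /psi /dpsi; apply: is_deriveB.
    apply: is_deriveB.
    apply: is_derive_eq.
    by rewrite scaler0 add0r [LHS]mulr1.
  apply: is_derive_eq.
  by rewrite /GRing.scale/= mulr0 add0r !mulr1; field.
have [c c01 cE] : exists2 c, c \in `]0, 1[%R & psi 1 - psi 0 = dpsi c * (1 - 0).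
  apply: MVT => //.
  apply: derivable_within_continuous => r _.
  by have [] := dp r.
have : dpsi c <= 0.
  move: c01; rewrite in_itv/= => /andP[c0 _].
  rewrite /dpsi.
  set D := gradient f (x + c *: v) - gradient f x.
  have DD := smooth_sqr x (x + c *: v).
  have -> : edot (gradient f (x + c *: v)) v - edot (gradient f x) v = edot D v.
    by rewrite /D !edotE.
  rewrite -/D [x + _]addrC addrK in DD.
  clearbody D; rewrite !edotE in DD.
  have Lc : 0 < L * c by rewrite mulr_gt0.
  (* [0 <= |D - L c v|^2] and [|D| <= L c |v|] give [<D, v> <= L c |v|^2] *)
  have := edot_ge0 (D - (L * c) *: v); rewrite !edotE (edotC v D) => H.
  rewrite -(pmulr_rle0 _ Lc); nra.
have : psi 1 - psi 0 <= 0 ->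
    f (x + v) <= f x + edot (gradient f x) v + L / 2 * edot v v.
  rewrite /psi scale1r scale0r addr0; lra.
by move=> H dc; apply: H; rewrite cE subr0 mulr1.
Qed.
End Descent.

(** * Borel measurability of vector-valued maps *)

Section BorelVectors.
Context {R : realType} {d : nat}.

Lemma continuous_borel_rV (F : 'rV[R]_d -> R) :
  continuous F -> measurable_fun setT (F : borel_rV R d -> R).
Proof.
move=> /continuousP cF.
apply: (measurability _ (measurable_realfun.RGenOpens.measurableE R)).
move=> _ [_ [a [b ->] <-]]; rewrite setTI; apply: sub_sigma_algebra.
exact/cF/interval_open.
Qed.

(** Second countability of the sup-norm topology: the index type is countable, and a cube is a
    finite intersection of conditions on coordinates. This reduces Borel measurability of
    vector-valued maps to that of their coordinates. *)
Lemma open_rational_balls (U : set 'rV[R]_d) : open U ->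
  U = \bigcup_(p in [set p : 'rV[rat]_d * nat |
        [set y : 'rV[R]_d | forall i,
          `|ratr (p.1 0 i) - y 0 i| < p.2.+1%:R^-1] `<=` U])
      [set y : 'rV[R]_d | forall i, `|ratr (p.1 0 i) - y 0 i| < p.2.+1%:R^-1].
Proof.
move=> oU; apply/seteqP; split => [x Ux|x [p pU]]; last exact: pU.
have /nbhs_ballP[e /= e0 eU] : nbhs x U by exact: open_nbhs_nbhs.
(* Half the radius, because the cube is centred at a rational point near [x] and must still lie in
   the [e]-ball about [x]. *)
have [n ne] : exists n, n.+1%:R^-1 < e / 2.
  have /ltr_add_invr[n] : 0 < e / 2 by rewrite divr_gt0.
  by exists n; rewrite -[ltLHS]add0r.
have n0 : 0 < n.+1%:R^-1 :> R by rewrite invr_gt0.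
have /choice[q xq] i : exists q : rat, `|ratr q - x 0 i| < n.+1%:R^-1.
  have [|q] := @rat_in_itvoo R (x 0 i - n.+1%:R^-1) (x 0 i + n.+1%:R^-1).
    by rewrite ltrBlDr -addrA ltrDl addr_gt0.
  by rewrite in_itv /= => H; exists q; rewrite ltr_distl.
exists (\row_i q i, n) => /= [y qy|i]; last by rewrite mxE.
apply: eU; split => // i j; rewrite ord1 /ball /=.
have := qy j; rewrite mxE => {}qy.
rewrite (le_lt_trans (ler_distD (ratr (q j)) _ _))//.
by rewrite [e]splitr ltrD// ?(lt_trans _ ne)// distrC.
Qed.

Lemma measurable_coord i : measurable_fun setT (fun x : borel_rV R d => x 0 i).
Proof. by apply: continuous_borel_rV; exact: coord_continuous. Qed.

Lemma measurable_borel_rV d' (T : measurableType d') (h : T -> borel_rV R d) :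
  (forall i, measurable_fun setT (fun w => h w 0 i)) -> measurable_fun setT h.
Proof.
move=> mh; have gE : @measurable _ (borel_rV R d) = <<s @open 'rV[R]_d >> by [].
apply: (measurability _ gE).
move=> _ [U oU <-]; rewrite setTI (open_rational_balls oU) preimage_bigcup.
rewrite bigcup_mkcond; apply: countable_bigcupT_measurable => // p.
case: ifPn => // _.
rewrite (_ : _ @^-1` _ = \bigcap_(i in [set: 'I_d])
    (fun w => `|ratr (p.1 0 i) - h w 0 i|) @^-1` `]-oo, p.2.+1%:R^-1[%classic).
  apply: fin_bigcap_measurable => // i _; rewrite -[X in measurable X]setTI.
  have : measurable_fun setT (fun w => `|ratr (p.1 0 i) - h w 0 i|).
    by apply: measurableT_comp => //; apply: measurable_funB.
  by apply => //; exact: measurable_itv.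
apply/seteqP; split => w /= H i; [move=> _|];
  by have := H i; rewrite /= in_itv//=; apply.
Qed.

Lemma measurable_edot d' (T : measurableType d') (u v : T -> borel_rV R d) :
  measurable_fun setT u -> measurable_fun setT v ->
  measurable_fun setT (fun w => edot (u w) (v w)).
Proof.
move=> mu mv; apply: measurable_sum => i.
by apply: measurable_funM; [exact: (measurableT_comp (measurable_coord i) mu)|
  exact: (measurableT_comp (measurable_coord i) mv)].
Qed.

Lemma measurable_rV_add d' (T : measurableType d') (u v : T -> borel_rV R d) :
  measurable_fun setT u -> measurable_fun setT v ->
  measurable_fun setT (fun w => (u w + v w : 'rV[R]_d) : borel_rV R d).
Proof.
move=> mu mv; apply: measurable_borel_rV => i; under eq_fun do rewrite mxE.
by apply: measurable_funD; [exact: (measurableT_comp (measurable_coord i) mu)|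
  exact: (measurableT_comp (measurable_coord i) mv)].
Qed.

Lemma measurable_rV_scale d' (T : measurableType d') (u : T -> borel_rV R d) a :
  measurable_fun setT u ->
  measurable_fun setT (fun w => (a *: (u w : 'rV[R]_d)) : borel_rV R d).
Proof.
move=> mu; apply: measurable_borel_rV => i; under eq_fun do rewrite mxE.
by apply: measurable_funM => //; exact: (measurableT_comp (measurable_coord i) mu).
Qed.

Lemma measurable_rV_sub d' (T : measurableType d') (u v : T -> borel_rV R d) :
  measurable_fun setT u -> measurable_fun setT v ->
  measurable_fun setT (fun w => (u w - v w : 'rV[R]_d) : borel_rV R d).
Proof.
move=> mu mv; apply: measurable_rV_add => //.
by under eq_fun do rewrite -scaleN1r; exact: measurable_rV_scale.
Qed.

Lemma measurable_smooth (f : 'rV[R]_d -> R) L : smooth L f ->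
  measurable_fun setT (f : borel_rV R d -> R).
Proof.
move=> [df _]; apply: continuous_borel_rV => x; exact: differentiable_continuous.
Qed.

Lemma measurable_gradient (f : 'rV[R]_d -> R) L : 0 < L -> smooth L f ->
  measurable_fun setT (gradient f : borel_rV R d -> borel_rV R d).
Proof.
move=> L0 [_ lipf]; apply: measurable_borel_rV => i.
suff cg : continuous (fun x : 'rV[R]_d => gradient f x 0 i).
  exact: continuous_borel_rV cg.
move=> x; apply/(cvgrPdist_lt (FF := nbhs_filter x)) => e e0.
(* The factor [sqrt d] compares the Euclidean norm with the sup norm; the added 1 keeps the constant
   positive when [d = 0] and makes the final inequality strict. *)
have K0 : 0 < L * (Num.sqrt d%:R + 1) by rewrite mulr_gt0// ltr_wpDl.
near=> y.
rewrite distrC (_ : _ - _ = (gradient f y - gradient f x) 0 i); last by rewrite !mxE.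
rewrite (le_lt_trans (coord_le_enorm _ _))// (le_lt_trans (lipf _ _))//.
have : ball x (e / (L * (Num.sqrt d%:R + 1))) y.
  by near: y; apply: nbhsx_ballx; rewrite divr_gt0.
move=> [r0 xy].
have := @enorm_le_sqrt R d _ (y - x) (ltW r0) _ => H.
have {}H : enorm (y - x) <= Num.sqrt d%:R * (e / (L * (Num.sqrt d%:R + 1))).
  by apply: H => j; rewrite !mxE distrC; apply: ltW; exact: xy.
apply: (@le_lt_trans _ _ (L * (Num.sqrt d%:R * (e / (L * (Num.sqrt d%:R + 1)))))).
  by rewrite ler_wpM2l// ltW.
rewrite !mulrA ltr_pdivrMr ?mulr_gt0 ?ltr_wpDl// [ltRHS]mulrC ltr_pM2r//.
by rewrite ltr_pM2l// ltrDl.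
Unshelve. all: by end_near. Qed.

End BorelVectors.

(** * Integration against a fresh sample *)

Section Freezing.
Local Open Scope ereal_scope.
Context d1 d2 d3 (Omega : measurableType d1) (T1 : measurableType d2)
  (T2 : measurableType d3) (R : realType) (P : probability Omega R).

(** Independence makes the law of [(Y, Z)] the product of the marginal laws, so Tonelli gives an
    iterated integral, whose inner one depends on [Z] only through its law. *)
Lemma integral_independent_pair (Y : {mfun Omega >-> T1})
    (Z Z' : {mfun Omega >-> T2}) (H : T1 * T2 -> \bar R) :
  (forall A B, measurable A -> measurable B ->
     P (Y @^-1` A `&` Z @^-1` B) = P (Y @^-1` A) * P (Z @^-1` B)) ->
  (forall B, measurable B -> P (Z @^-1` B) = P (Z' @^-1` B)) ->
  measurable_fun setT H -> (forall p, 0 <= H p) ->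
  \int[P]_w H (Y w, Z w) = \int[P]_w \int[P]_w' H (Y w, Z' w').
Proof.
move=> indep lawZ mH H0.
have mYZ : measurable_fun setT (fun w => (Y w, Z w)).
  by apply: measurable_fun_pair => //; exact: measurable_funP.
pose J : {mfun Omega >-> (T1 * T2)%type} := mfun_Sub (mem_set mYZ).
rewrite [LHS](_ : _ = \int[distribution P J]_p H p); last first.
  by rewrite ge0_integral_distribution.
rewrite -(@eq_measure_integral _ _ _ _ _ (distribution P Y \x distribution P Z)).
  rewrite fubini_tonelli1// ge0_integral_distribution//; last 2 first.
  - exact: measurable_fun_fubini_tonelli_F.
  - by move=> y; exact: integral_ge0.
  apply: eq_integral => w _ /=; rewrite /fubini_F.
  have mHw : measurable_fun setT (fun z => H (Y w, z)) by exact: measurableT_comp.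
  rewrite (@eq_measure_integral _ _ _ _ (distribution P Z')) => [|B mB _].
    by rewrite ge0_integral_distribution.
  exact: lawZ.
by move=> A mA _; apply: product_measure_unique => // B C mB mC; exact: indep.
Qed.

End Freezing.

Section Past.
Context d1 d2 (Omega : measurableType d1) (Xi : measurableType d2)
  (R : realType) (P : probability Omega R) (X : nat -> {RV P >-> Xi}).

(* A pi-system generating the sigma-algebra of X 0, ..., X k.-1.  Carrying    *)
(* this sigma-algebra on Omega makes H (w, X k w) an integrand with past and  *)
(* fresh variables separated, for integral_past_fresh.                        *)
Definition past (k : nat) : set (set Omega) :=
  [set E | exists2 A : nat -> set Xi, (forall j, measurable (A j)) &
     E = \bigcap_(j in `I_k) X j @^-1` A j].

Definition pastT k := g_sigma_algebraType (past k).

Lemma past_measurable k : past k `<=` measurable.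
Proof.
move=> _ [A mA ->]; apply: fin_bigcap_measurable => // j _.
exact: measurable_funPTI.
Qed.

Lemma past_setI k : setI_closed (past k).
Proof.
move=> _ _ [A mA ->] [B mB ->]; exists (fun j => A j `&` B j).
  by move=> j; exact: measurableI.
by rewrite -bigcapI; apply: eq_bigcapr => j _; rewrite preimage_setI.
Qed.

Lemma past_setT k : past k setT.
Proof. by exists (fun=> setT) => //; apply/seteqP; split. Qed.

Lemma past_nondecreasing k l : (k <= l)%N -> past k `<=` past l.
Proof.
move=> kl _ [A mA ->]; exists (fun j => if (j < k)%N then A j else setT).
  by move=> j; case: ifP.
apply/seteqP; split => w Aw j /= jk; first by case: ifP => // /Aw.
by have := Aw j (leq_trans jk kl); rewrite /= jk.
Qed.

Lemma past_preimage k j B : (j < k)%N -> measurable B -> past k (X j @^-1` B).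
Proof.
move=> jk mB; exists (fun i => if i == j then B else setT).
  by move=> i; case: ifP.
apply/seteqP; split => [w Bw i _|w /(_ j jk)] /=; last by rewrite eqxx.
by case: eqP => [->|].
Qed.

Lemma measurable_past_id k : measurable_fun setT (id : Omega -> pastT k).
Proof.
move=> _ E mE; rewrite setTI; move: E mE; apply: smallest_sub.
  exact: sigma_algebra_measurable.
exact: past_measurable.
Qed.

Lemma measurable_past_le k l d (T : measurableType d) (h : Omega -> T) :
  (k <= l)%N -> measurable_fun setT (h : pastT k -> T) ->
  measurable_fun setT (h : pastT l -> T).
Proof.
move=> kl mh _ E mE; have := mh measurableT E mE.
exact: sub_sigma_algebra2 (past_nondecreasing kl) _.
Qed.

Lemma measurable_past k j : (j < k)%N ->
  measurable_fun setT (X j : pastT k -> Xi).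
Proof.
move=> jk _ B mB; rewrite setTI; apply: sub_sigma_algebra; exact: past_preimage.
Qed.

Hypothesis indep : mutually_independent X.
Local Open Scope ereal_scope.

Lemma cylinder_prob k (A : nat -> set Xi) : (forall j, measurable (A j)) ->
  P (\bigcap_(j in `I_k) X j @^-1` A j) = \prod_(0 <= j < k) P (X j @^-1` A j).
Proof.
move=> mA; have := indep [fset j | j in iota 0 k]%fset mA.
rewrite (_ : [set` _] = `I_k); last first.
  by apply/seteqP; split => j /=; rewrite !inE mem_iota.
move=> ->; apply: perm_big; apply: uniq_perm; rewrite ?fset_uniq ?iota_uniq// => j.
by rewrite !inE /index_iota subn0.
Qed.

(** As functions of [E], both sides are finite measures: a restriction of [P] and a multiple of [P].
    They agree on the pi-system [past k], hence on the sigma-algebra it generates. *)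
Lemma past_independent k E B : <<s past k >> E -> measurable B ->
  P (E `&` X k @^-1` B) = P E * P (X k @^-1` B).
Proof.
move=> sE mB.
have mXB : measurable (X k @^-1` B) by exact: measurable_funPTI.
have PB0 : (0 <= fine (P (X k @^-1` B)))%R by exact: fine_ge0.
rewrite [RHS]muleC -[P (X k @^-1` B)]fineK ?fin_num_measure//.
apply: (g_sigma_algebra_measure_unique (past k) (@past_measurable k) (fun=> setT)
  _ _ (mrestr P mXB) (mscale (NngNum PB0) P)) => //.
- by move=> _; exact: past_setT.
- by rewrite bigcup_const.
- exact: past_setI.
- move=> _ [A mA ->]; set C := \bigcap_(j < k) _.
  change (P (C `&` X k @^-1` B) = (fine (P (X k @^-1` B)))%:E * P C).
  rewrite fineK ?fin_num_measure// muleC [P C]cylinder_prob//.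
  (* Intersecting with the event on [X k] turns a cylinder over [k] samples into one over [k.+1],
     where independence applies. *)
  pose A' j := if j == k then B else A j.
  have mA' j : measurable (A' j) by rewrite /A'; case: ifP.
  have A'k : A' k = B by rewrite /A' eqxx.
  have A'j j : (j < k)%N -> A' j = A j by move=> jk; rewrite /A' (ltn_eqF jk).
  have := cylinder_prob k.+1 mA'.
  rewrite big_nat_recr//= A'k.
  rewrite (eq_big_nat _ _ (F2 := fun j => P (X j @^-1` A j))); last first.
    by move=> j /andP[_ jk]; rewrite A'j.
  move=> <-; congr (P _); apply/seteqP; split => [w [Aw Bw] j /=|w Aw].
    rewrite ltnS leq_eqVlt => /orP[/eqP ->|jk]; first by rewrite A'k.
    by rewrite A'j//; exact: Aw.
  split; last by have := Aw k (ltnSn k); rewrite /= A'k.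
  by move=> j /= jk; have := Aw j (ltnW jk); rewrite /= A'j.
- move=> _; change (P (setT `&` X k @^-1` B) < +oo).
  by rewrite setTI ltey_eq fin_num_measure.
Qed.

Lemma integral_past_fresh (xi : {RV P >-> Xi}) k (H : pastT k * Xi -> \bar R) :
  same_law (X k) xi -> measurable_fun setT H -> (forall p, 0 <= H p) ->
  \int[P]_w H (w, X k w) = \int[P]_w \int[P]_w' H (w, xi w').
Proof.
move=> law mH H0.
pose Y : {mfun Omega >-> pastT k} := mfun_Sub (mem_set (@measurable_past_id k)).
apply: (integral_independent_pair (Y := Y)) => // A B mA mB.
exact: past_independent.
Qed.

Lemma measurable_integral_fresh (xi : {RV P >-> Xi}) k
    (H : pastT k * Xi -> \bar R) :
  measurable_fun setT H -> (forall p, 0 <= H p) ->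
  measurable_fun setT (fun w : Omega => \int[P]_w' H (w, xi w')).
Proof.
move=> mH H0.
have := measurable_fun_fubini_tonelli_F (m2 := distribution P xi) H mH H0.
move=> /measurableT_comp /(_ (@measurable_past_id k)).
apply: eq_measurable_fun => w _ /=; rewrite /fubini_F ge0_integral_distribution//.
exact: measurableT_comp.
Qed.

End Past.

(** * Unbiased noise of bounded variance at a fixed point *)

Section Means.
Context d1 (Omega : measurableType d1) (R : realType) (P : probability Omega R).
Implicit Types (F H : Omega -> R).

(** Integrability is bundled with a real value so that signed means combine linearly without side
    conditions. *)
Definition has_mean F (m : R) :=
  P.-integrable setT (EFin \o F) /\ (\int[P]_w (F w)%:E = m%:E)%E.

Lemma has_mean_cst (c : R) : has_mean (fun=> c) c.
Proof.
split; first exact: (finite_measure_integrable_cst P c).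
by rewrite integral_cst// [X in (_ * X)%E](probability_setT P) mule1.
Qed.

Lemma has_meanD F H m n : has_mean F m -> has_mean H n ->
  has_mean (fun w => F w + H w) (m + n).
Proof.
move=> [iF eF] [iH eH]; split.
  by under [X in integrable _ _ X]eq_fun do rewrite /= EFinD; exact: integrableD.
by under eq_integral do rewrite EFinD; rewrite [LHS]integralD_EFin// eF eH -EFinD.
Qed.

Lemma has_meanZ F (a m : R) : has_mean F m -> has_mean (fun w => a * F w) (a * m).
Proof.
move=> [iF eF]; split.
  by under [X in integrable _ _ X]eq_fun do rewrite /= EFinM; exact: integrableZl.
by under eq_integral do rewrite EFinM; rewrite [LHS]integralZl// eF -EFinM.
Qed.

Lemma has_mean_sum (I : Type) (s : seq I) (F : I -> Omega -> R) (m : I -> R) :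
  (forall i, has_mean (F i) (m i)) ->
  has_mean (fun w => \sum_(i <- s) F i w) (\sum_(i <- s) m i).
Proof.
move=> Fm; elim: s => [|i s IH].
  rewrite big_nil (_ : (fun _ => _) = (fun=> 0)); first exact: has_mean_cst.
  by apply/funext => w; rewrite big_nil.
rewrite big_cons (_ : (fun _ => _) = (fun w => F i w + \sum_(j <- s) F j w)).
  exact: has_meanD.
by apply/funext => w; rewrite big_cons.
Qed.

Lemma le_has_mean F H (m : R) :
  measurable_fun setT F -> (forall w, 0 <= F w <= H w) ->
  has_mean H m -> (\int[P]_w (F w)%:E <= m%:E)%E.
Proof.
move=> mF FH [iH <-]; apply: ge0_le_integral => //.
- by move=> w _; rewrite lee_fin; case/andP: (FH w).
- exact/measurable_EFinP.
- by case/integrableP : iH.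
- by move=> w _; rewrite lee_fin; case/andP: (FH w).
Qed.

End Means.

Section Noise.
Context d1 (Omega : measurableType d1) (R : realType) (P : probability Omega R)
  (d : nat) (Y : Omega -> borel_rV R d) (m : 'rV[R]_d) (sigma : R).
Hypotheses (mY : measurable_fun setT Y)
  (meanY : forall i, ('E_P[(fun w => Y w 0 i)%R] = (m 0 i)%:E)%E)
  (varY : ('E_P[(fun w => enorm ((Y w : 'rV[R]_d) - m) ^+ 2)%R]
             <= (sigma ^+ 2)%:E)%E).

Let N w := edot ((Y w : 'rV[R]_d) - m) ((Y w : 'rV[R]_d) - m).

Let mN : measurable_fun setT N.
Proof.
by apply: measurable_edot; apply: measurable_rV_sub => //; exact: measurable_cst.
Qed.

Lemma noise_sqr_mean : exists2 V, V <= sigma ^+ 2 & has_mean P N V.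
Proof.
have le : (\int[P]_w (N w)%:E <= (sigma ^+ 2)%:E)%E.
  move: varY; rewrite unlock => /(le_trans _); apply.
  by under [leRHS]eq_integral do rewrite enorm_sqr.
have ge : (0 <= \int[P]_w (N w)%:E)%E.
  by apply: integral_ge0 => w _; rewrite lee_fin edot_ge0.
have fin : (\int[P]_w (N w)%:E)%E \is a fin_num.
  by rewrite ge0_fin_numE// (le_lt_trans le) ?ltry.
exists (fine (\int[P]_w (N w)%:E)%E); first by rewrite -lee_fin fineK.
split; last by rewrite fineK.
apply/integrableP; split; first exact/measurable_EFinP.
under eq_integral do rewrite /= ger0_norm ?edot_ge0//.
by rewrite (le_lt_trans le) ?ltry.
Qed.

Lemma noise_dot_mean (u : 'rV[R]_d) :
  has_mean P (fun w => edot u ((Y w : 'rV[R]_d) - m)) 0.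
Proof.
have [V _ NV] := noise_sqr_mean.
have iY i : P.-integrable setT (EFin \o (fun w => Y w 0 i - m 0 i)).
  (* square integrability dominates the coordinates: [r <= 1 + r^2] *)
  apply: (@le_integrable _ _ _ _ _ measurableT _ (EFin \o (fun w => 1 + N w))).
  - apply/measurable_EFinP; apply: measurable_funB => //.
    exact: (measurableT_comp (measurable_coord i) mY).
  - move=> w _ /=; rewrite lee_fin (@ger0_norm _ (1 + N w)); last first.
      by rewrite addr_ge0// edot_ge0.
    have : ((Y w : 'rV[R]_d) - m) 0 i ^+ 2 <= N w.
      rewrite /N /edot (bigD1 i)//= -expr2 lerDl.
      by apply: sumr_ge0 => j _; rewrite -expr2 sqr_ge0.
    rewrite !mxE -real_normK ?num_real//; set r := `|_| => H.
    have := sqr_ge0 (r - 1); have : 0 <= r by exact: normr_ge0.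
    nra.
  - by have [] := has_meanD (has_mean_cst P 1) NV.
have Y0 i : has_mean P (fun w => Y w 0 i - m 0 i) 0.
  split; first exact: iY.
  have iYi : P.-integrable setT (EFin \o (fun w => Y w 0 i)).
    have := integrableD measurableT (iY i)
      (finite_measure_integrable_cst P (m 0 i) measurableT).
    by apply: eq_integrable => // w _ /=; rewrite -EFinD subrK.
  under eq_integral do rewrite EFinB.
  rewrite integralB_EFin//; last first.
    exact: (finite_measure_integrable_cst P (m 0 i) measurableT).
  have := meanY i; rewrite unlock => ->.
  by rewrite integral_cst// [X in (_ * X)%E](probability_setT P) mule1 subee.
have -> : (0 : R) = \sum_(i < d) u 0 i * 0.
  by rewrite big1// => i _; rewrite mulr0.
rewrite [X in has_mean P X](_ : _ =
    fun w => \sum_(i < d) u 0 i * (Y w 0 i - m 0 i)).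
  by apply: has_mean_sum => i; exact: has_meanZ.
by apply/funext => w; apply: eq_bigr => i _; rewrite !mxE.
Qed.

(** Common form of both conditional estimates: expanding a quadratic in the stochastic gradient
    around its mean leaves a constant, a linear term of mean zero and a multiple of the squared
    noise. *)
Lemma noise_bound (F : Omega -> R) (c b : R) (u : 'rV[R]_d) : 0 <= b ->
  measurable_fun setT F ->
  (forall w, 0 <= F w <= c + edot u ((Y w : 'rV[R]_d) - m) + b * N w) ->
  (\int[P]_w (F w)%:E <= (c + b * sigma ^+ 2)%:E)%E.
Proof.
move=> b0 mF FN; have [V Vs NV] := noise_sqr_mean.
have H := has_meanD (has_meanD (has_mean_cst P c) (noise_dot_mean u))
  (has_meanZ b NV).
apply: (le_trans (le_has_mean mF FN H)).
by rewrite lee_fin addr0 lerD2l ler_wpM2l.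
Qed.

End Noise.

(** * The recursion along the trajectory *)

(** Cost of one step: the drift [L / 2 |z_k - x_k|^2] at the uniform momentum bound, plus the
    variance term of an SGD step of size [alpha / (1 - beta)]. *)
Definition recursion_error (R : realType) (L sigma G alpha beta s : R) : R :=
  L / 2 * (beta / (1 - beta)) ^+ 2
    * ((((1 - beta) * s - 1) * alpha / (1 - beta)) ^+ 2 * (G ^+ 2 + sigma ^+ 2))
  + L * (alpha / (1 - beta)) ^+ 2 * sigma ^+ 2 / 2.

Section Recursion.
Context (R : realType) (d : nat) (f : 'rV[R]_d -> R) (L : R)
  (d1 d2 : measure_display) (Omega : measurableType d1)
  (Xi : measurableType d2) (P : probability Omega R)
  (g : 'rV[R]_d -> Xi -> 'rV[R]_d)
  (xi : {RV P >-> Xi}) (xis : nat -> {RV P >-> Xi}) (sigma G : R).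
Hypotheses (hL : 0 < L) (hf : smooth L f) (hfb : has_lbound (range f))
  (hgm : jointly_measurable g) (hindep : mutually_independent xis)
  (hlaw : forall k, same_law (xis k) xi) (hmean : unbiased xi g f)
  (hvar : variance_bounded xi g f sigma)
  (hG : forall x, enorm (gradient f x) <= G).

Let m := gradient f.
Let fmin := inf (range f).

Let measurable_sample x :
  measurable_fun setT (fun w => g x (xi w) : borel_rV R d).
Proof.
by apply: (measurableT_comp hgm (measurable_fun_pair _ _)).
Qed.

Let fmin_le x : fmin <= f x.
Proof. by apply: ge_inf => //; exists x. Qed.

Let mf : measurable_fun setT (f : borel_rV R d -> R).
Proof. exact: measurable_smooth hf. Qed.

Let mm : measurable_fun setT (m : borel_rV R d -> borel_rV R d).
Proof. exact: measurable_gradient hL hf. Qed.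

Lemma conditional_descent (a : R) (x z : 'rV[R]_d) : 0 < a -> 2 * L * a <= 1 ->
  (\int[P]_w (f (z - a *: g x (xi w)) - fmin)%:E
     + (a / 2 * edot (m x) (m x))%:E
   <= (f z - fmin + L / 2 * edot (z - x) (z - x)
         + L * a ^+ 2 * sigma ^+ 2 / 2)%:E)%E.
Proof.
move=> a0 La.
(* [c], [u] and [b] are the coefficients of the descent lemma at [z] after writing [g x] as [m x]
   plus noise. *)
pose c := f z - fmin - a * edot (m z) (m x) + L / 2 * a ^+ 2 * edot (m x) (m x).
pose u := - a *: m z + (L * a ^+ 2) *: m x.
pose b := L * a ^+ 2 / 2.
have b0 : 0 <= b by rewrite divr_ge0// mulr_ge0 ?sqr_ge0// ltW.
have mF : measurable_fun setT (fun w => f (z - a *: g x (xi w)) - fmin).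
  apply: measurable_funB => //; apply: measurableT_comp mf _.
  by apply: measurable_rV_sub => //; exact: measurable_rV_scale.
have H := noise_bound (measurable_sample x) (hmean x) (hvar x)
  (u := u) (c := c) b0 mF.
apply: (@le_trans _ _
  ((c + b * sigma ^+ 2)%:E + (a / 2 * edot (m x) (m x))%:E)%E).
  apply: leeD2r; apply: H => w; rewrite subr_ge0 fmin_le/=.
  have := descent hL hf z (- a *: g x (xi w)).
  rewrite /c /u /b -/m; move: (g x (xi w)) (m z) (m x) => gx mz mx.
  rewrite scaleNr; set fz' := f _; rewrite !edotE (edotC gx mx); lra.
rewrite -EFinD lee_fin /c /b.
have := smooth_sqr hL hf x z; rewrite -/m; set D := edot (z - x) _.
(* Young's inequality for [- a <grad f z - grad f x, grad f x>], with the     *)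
(* weight for which smoothness turns the first square into [L / 2 |z - x|^2]  *)
have := edot_ge0 ((m z - m x) + (L * a) *: m x).
move: (m z) (m x) => mz mx; rewrite !edotE (edotC mx mz) => H1 H2.
have X0 : 0 <= edot mx mx by exact: edot_ge0.
rewrite -subr_ge0 -(pmulr_rge0 _ hL).
have : 0 <= L * a * (1 - 2 * L * a) * edot mx mx.
  by rewrite !mulr_ge0 ?subr_ge0// ltW.
nra.
Qed.

Lemma conditional_momentum (beta q : R) (x v : 'rV[R]_d) : 0 <= beta < 1 ->
  (\int[P]_w (edot (beta *: v + q *: g x (xi w))
                   (beta *: v + q *: g x (xi w)))%:E
   <= (beta * edot v v
        + q ^+ 2 / (1 - beta) * (G ^+ 2 + sigma ^+ 2))%:E)%E.
Proof.
move=> /andP[b0 b1].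
have b1' : 0 < 1 - beta by rewrite subr_gt0.
pose b := q ^+ 2 / (1 - beta).
pose c := beta * edot v v + b * edot (m x) (m x).
pose u := (2 * b) *: m x.
have bge0 : 0 <= b by rewrite divr_ge0 ?sqr_ge0 ?ltW.
have mF : measurable_fun setT
    (fun w => edot (beta *: v + q *: g x (xi w)) (beta *: v + q *: g x (xi w))).
  by apply: measurable_edot; apply: measurable_rV_add => //;
    exact: measurable_rV_scale.
apply: (le_trans (noise_bound (measurable_sample x) (hmean x) (hvar x)
  (u := u) (c := c) bge0 mF _)).
  move=> w; rewrite edot_ge0/= /c /u -/m.
  (* convexity of the square: the step is the mean of [v] and               *)
  (* [q / (1 - beta) g] with weights [beta] and [1 - beta]                  *)
  have := edot_ge0 (v - (q / (1 - beta)) *: g x (xi w)).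
  move: (g x (xi w)) (m x) => gx mx.
  rewrite !edotE (edotC gx mx) (edotC gx v) => H.
  rewrite -subr_ge0.
  have {H} := mulr_ge0 (mulr_ge0 b0 (ltW b1')) H.
  rewrite /b; set X := edot v v; set Y := edot v gx; set Z := edot gx gx.
  move=> H; apply: (le_trans H); rewrite le_eqVlt; apply/orP; left; apply/eqP.
  by field; rewrite gt_eqF.
rewrite lee_fin /c -addrA lerD2l -mulrDr ler_wpM2l// lerD2r -enorm_sqr.
by rewrite lerXn2r ?nnegrE ?enorm_ge0// (le_trans _ (hG x))// enorm_ge0.
Qed.

(** * The trajectory in expectation *)

Context (alpha beta s : R) (x0 : 'rV[R]_d).
Hypotheses (halpha : 0 < alpha) (hbeta : 0 <= beta < 1)
  (hstep : 2 * L * (alpha / (1 - beta)) <= 1).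

Let a := alpha / (1 - beta).
Let q := ((1 - beta) * s - 1) * alpha.
Let p := beta / (1 - beta).

Let state k (w : Omega) := sum_state g alpha beta s x0 (fun j => xis j w) k.
Let x k w : 'rV[R]_d := (state k w).1.
Let v k w : 'rV[R]_d := (state k w).1 - (state k w).2.
Let z k w : 'rV[R]_d := x k w + p *: v k w.

Let b1 : 0 < 1 - beta.
Proof. by rewrite subr_gt0; case/andP: hbeta. Qed.

Let a0 : 0 < a.
Proof. exact: divr_gt0. Qed.

(** The weight [p] solves [beta + p * beta = p], which preserves the coefficient of [v k]; the terms
    in [s] cancel because [p * q = beta * s * alpha - p * alpha]. *)
Let z_succ k w : z k.+1 w = z k w - a *: g (x k w) (xis k w).
Proof.
rewrite /z /x /v /state /=; case: (sum_state _ _ _ _ _ _ k) => xk yk /=.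
by apply/rowP => i; rewrite !mxE /a /p; field; rewrite gt_eqF.
Qed.

Let v_succ k w : v k.+1 w = beta *: v k w + q *: g (x k w) (xis k w).
Proof.
rewrite /v /x /state /=; case: (sum_state _ _ _ _ _ _ k) => xk yk /=.
by apply/rowP => i; rewrite !mxE /q; ring.
Qed.

(** The iterates are adapted: the state at time [k] uses samples of index below [k] only, so [xis k]
    is fresh for it. *)
Let measurable_state k :
  measurable_fun setT ((x k : _ -> borel_rV R d) : pastT xis k -> _) /\
  measurable_fun setT
    (((fun w => (state k w).2) : _ -> borel_rV R d) : pastT xis k -> _).
Proof.
elim: k => [|k [mx my]]; first by split; exact: measurable_cst.
have {}mx := measurable_past_le (leqnSn k) mx.
have {}my := measurable_past_le (leqnSn k) my.
have mg : measurable_fun setT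
    ((fun w => g (x k w) (xis k w) : borel_rV R d) : pastT xis k.+1 -> _).
  apply: (measurableT_comp hgm (measurable_fun_pair mx _)).
  exact: measurable_past.
have mys : measurable_fun setT
    (((fun w => (state k.+1 w).2) : _ -> borel_rV R d) : pastT xis k.+1 -> _).
  rewrite (_ : (fun w => _) =
    (fun w => x k w - (s * alpha) *: g (x k w) (xis k w))).
    by apply: measurable_rV_sub => //; exact: measurable_rV_scale.
  by apply/funext => w; rewrite /x /state /=; case: (sum_state _ _ _ _ _ _ k).
split => //.
rewrite (_ : x k.+1 = (fun w => (x k w - alpha *: g (x k w) (xis k w))
    + beta *: ((state k.+1 w).2 - (state k w).2))).
  apply: measurable_rV_add.
    by apply: measurable_rV_sub => //; exact: measurable_rV_scale.
  by apply: measurable_rV_scale; exact: measurable_rV_sub.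
by apply/funext => w; rewrite /x /state /=; case: (sum_state _ _ _ _ _ _ k).
Qed.

Let mx k : measurable_fun setT ((x k : _ -> borel_rV R d) : pastT xis k -> _).
Proof. by case: (measurable_state k). Qed.

Let mv k : measurable_fun setT ((v k : _ -> borel_rV R d) : pastT xis k -> _).
Proof. by case: (measurable_state k) => ? ?; exact: measurable_rV_sub. Qed.

Let mz k : measurable_fun setT ((z k : _ -> borel_rV R d) : pastT xis k -> _).
Proof. by apply: measurable_rV_add => //; exact: measurable_rV_scale. Qed.

Let measurable_forget_past k d' (T : measurableType d') (h : Omega -> T) :
  measurable_fun setT (h : pastT xis k -> T) -> measurable_fun setT h.
Proof.
by move=> mh; exact: (measurableT_comp mh (@measurable_past_id _ _ _ _ _ _ xis k)).
Qed.

Let measurable_sample_past k : measurable_fun setT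
  (fun wy : (pastT xis k * Xi)%type => g (x k wy.1) wy.2 : borel_rV R d).
Proof.
have mx1 : measurable_fun setT
    (fun wy : (pastT xis k * Xi)%type => x k wy.1 : borel_rV R d).
  exact: (measurableT_comp (@mx k) measurable_fst).
have mxy := measurable_fun_pair mx1 (@measurable_snd _ _ (pastT xis k) Xi).
exact: (measurableT_comp hgm mxy).
Qed.

Local Open Scope ereal_scope.

Let Egap k := \int[P]_w (f (z k w) - fmin)%:E.
Let Egrad k := \int[P]_w (edot (m (x k w)) (m (x k w)))%:E.
Let Emom k := \int[P]_w (edot (v k w) (v k w))%:E.

Let mgap k : measurable_fun setT (fun w => (f (z k w) - fmin)%:E).
Proof.
apply/measurable_EFinP; apply: measurable_funB => //.
by apply: (@measurable_forget_past k); exact: (measurableT_comp mf (@mz k)).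
Qed.

Let mgrad k : measurable_fun setT (fun w => (edot (m (x k w)) (m (x k w)))%:E).
Proof.
apply/measurable_EFinP; apply: (@measurable_forget_past k).
by apply: measurable_edot; exact: (measurableT_comp mm (@mx k)).
Qed.

Let mmom k : measurable_fun setT (fun w => (edot (v k w) (v k w))%:E).
Proof.
by apply/measurable_EFinP; apply: (@measurable_forget_past k); apply: measurable_edot.
Qed.

(** The bound is the fixed point of the affine recursion with slope [beta] from
    [conditional_momentum], and the momentum starts at 0. *)
Lemma expected_momentum_le k :
  Emom k <= ((q / (1 - beta)) ^+ 2 * (G ^+ 2 + sigma ^+ 2))%:E.
Proof.
have GS : (0 <= G ^+ 2 + sigma ^+ 2)%R by rewrite addr_ge0 ?sqr_ge0.
elim: k => [|k IH].
  rewrite /Emom integral0_eq => [|w _]; first by rewrite lee_fin mulr_ge0 ?sqr_ge0.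
  by rewrite /v /state /= subrr /edot big1// => i _; rewrite mxE mul0r.
rewrite /Emom; under eq_integral do rewrite v_succ.
pose H (wy : pastT xis k * Xi) :=
  (edot (beta *: v k wy.1 + q *: g (x k wy.1) wy.2)
        (beta *: v k wy.1 + q *: g (x k wy.1) wy.2))%:E.
have mH : measurable_fun setT H.
  apply/measurable_EFinP.
  by apply: measurable_edot; apply: measurable_rV_add;
    apply: measurable_rV_scale => //; exact: (measurableT_comp (@mv k) measurable_fst).
have H0 wy : 0 <= H wy by rewrite lee_fin edot_ge0.
rewrite [leLHS](integral_past_fresh hindep (hlaw k) mH H0).
apply: (@le_trans _ _ (\int[P]_w (beta%:E * (edot (v k w) (v k w))%:E
    + (q ^+ 2 / (1 - beta) * (G ^+ 2 + sigma ^+ 2))%:E))).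
  apply: ge0_le_integral => //.
  - by move=> w _; exact: integral_ge0.
  - exact: measurable_integral_fresh.
  - by apply: emeasurable_funD => //; exact: measurable_funeM.
  - move=> w _; apply: (le_trans (conditional_momentum q (x k w) (v k w) hbeta)).
    by rewrite -EFinM -EFinD.
have /andP[be0 _] := hbeta.
have K0 : (0 <= q ^+ 2 / (1 - beta) * (G ^+ 2 + sigma ^+ 2))%R.
  by rewrite mulr_ge0// divr_ge0 ?sqr_ge0// ltW.
rewrite ge0_integralD//; last 2 first.
- by move=> w _; rewrite mule_ge0// lee_fin edot_ge0.
- exact: measurable_funeM.
rewrite ge0_integralZl_EFin//; last by move=> w _; rewrite lee_fin edot_ge0.
rewrite integral_cst// [X in _ + _ * X](probability_setT P) mule1.
apply: (@le_trans _ _ (beta%:E * ((q / (1 - beta)) ^+ 2 * (G ^+ 2 + sigma ^+ 2))%:E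
   + (q ^+ 2 / (1 - beta) * (G ^+ 2 + sigma ^+ 2))%:E)).
  by apply: leeD2r; apply: lee_wpmul2l => //; rewrite lee_fin.
rewrite -EFinM -EFinD lee_fin le_eqVlt; apply/orP; left; apply/eqP.
by field; rewrite gt_eqF.
Qed.

Let err := recursion_error L sigma G alpha beta s.

(** [conditional_descent] at [x k] and [z k], integrated over the past; since
    [z k - x k = p *: v k], the drift is a multiple of [Emom k]. *)
Lemma expected_descent k :
  Egap k.+1 + (a / 2)%:E * Egrad k <= Egap k + err%:E.
Proof.
pose H (wy : pastT xis k * Xi) :=
  (f (z k wy.1 - a *: g (x k wy.1) wy.2) - fmin)%:E.
have mH : measurable_fun setT H.
  apply/measurable_EFinP; apply: measurable_funB => //.
  apply: (measurableT_comp mf); apply: measurable_rV_sub.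
    exact: (measurableT_comp (@mz k) measurable_fst).
  exact: measurable_rV_scale.
have H0 wy : 0 <= H wy by rewrite lee_fin subr_ge0 fmin_le.
have a20 : (0 <= a / 2)%R by rewrite divr_ge0// ltW.
rewrite {1}/Egap; under eq_integral do rewrite z_succ.
rewrite [X in X + _](integral_past_fresh hindep (hlaw k) mH H0).
rewrite /Egrad -ge0_integralZl_EFin//; last first.
  by move=> w _; rewrite lee_fin edot_ge0.
rewrite -ge0_integralD//; last 4 first.
- by move=> w _; exact: integral_ge0.
- exact: measurable_integral_fresh.
- by move=> w _; rewrite mule_ge0// lee_fin ?edot_ge0.
- exact: measurable_funeM.
have K0 : (0 <= L * a ^+ 2 * sigma ^+ 2 / 2)%R.
  by rewrite divr_ge0// mulr_ge0 ?sqr_ge0// mulr_ge0 ?sqr_ge0// ltW.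
have Lp0 : (0 <= L / 2 * p ^+ 2)%R by rewrite mulr_ge0 ?sqr_ge0// divr_ge0// ltW.
apply: (@le_trans _ _ (\int[P]_w ((f (z k w) - fmin)%:E
    + ((L / 2 * p ^+ 2)%:E * (edot (v k w) (v k w))%:E
    + (L * a ^+ 2 * sigma ^+ 2 / 2)%:E)))).
  apply: ge0_le_integral => //.
  - move=> w _; rewrite adde_ge0//; first exact: integral_ge0.
    by rewrite mule_ge0// lee_fin ?edot_ge0.
  - apply: emeasurable_funD; first exact: measurable_integral_fresh.
    exact: measurable_funeM.
  - by do 2 (apply: emeasurable_funD => //); exact: measurable_funeM.
  - move=> w _; apply: (le_trans (conditional_descent (x k w) (z k w) a0 hstep)).
    rewrite -EFinM -!EFinD lee_fin /z [(x k w + _)%R]addrC addrK !edotE.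
    by rewrite le_eqVlt; apply/orP; left; apply/eqP; ring.
rewrite ge0_integralD//; last 3 first.
- by move=> w _; rewrite lee_fin subr_ge0 fmin_le.
- by move=> w _; rewrite adde_ge0// ?mule_ge0// lee_fin// edot_ge0.
- by apply: emeasurable_funD => //; exact: measurable_funeM.
rewrite leeD2l// ge0_integralD//; last 2 first.
- by move=> w _; rewrite mule_ge0// lee_fin edot_ge0.
- exact: measurable_funeM.
rewrite ge0_integralZl_EFin//; last by move=> w _; rewrite lee_fin edot_ge0.
rewrite integral_cst// [X in _ + _ * X](probability_setT P) mule1.
rewrite /err /recursion_error EFinD.
rewrite leeD2r// [leRHS]EFinM lee_wpmul2l ?lee_fin//.
exact: expected_momentum_le.
Qed.

Lemma expected_descent_sum n :
  Egap n + (a / 2)%:E * (\sum_(k < n) Egrad k)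
    <= (f x0 - fmin + n%:R * err)%:E.
Proof.
elim: n => [|n IH].
  rewrite big_ord0 mule0 adde0 mul0r addr0 /Egap.
  under eq_integral do rewrite /z /v /x /state /= subrr scaler0 addr0.
  by rewrite integral_cst// [X in _ * X](probability_setT P) mule1.
have G0 k : 0 <= Egrad k by apply: integral_ge0 => w _; rewrite lee_fin edot_ge0.
rewrite big_ord_recr/= ge0_muleDr ?sume_ge0// addeCA.
apply: (le_trans (leeD2l _ (expected_descent n))).
rewrite addeA [X in X + _]addeC -[(n.+1%:R)%R]natr1 mulrDl mul1r addrA EFinD.
exact: (leeD2r _ IH).
Qed.

Lemma sum_expected_gradient n :
  (alpha / (1 - beta) / 2)%:E
    * \sum_(k < n) 'E_P[(fun w => enorm (gradient f
        (sum_iter g alpha beta s x0 (fun j => xis j w) k)) ^+ 2)%R]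
  <= (f x0 - inf (range f) + n%:R * recursion_error L sigma G alpha beta s)%:E.
Proof.
apply: le_trans (expected_descent_sum n); rewrite -[leLHS]add0e; apply: leeD.
  by apply: integral_ge0 => w _; rewrite lee_fin subr_ge0 fmin_le.
rewrite le_eqVlt; apply/orP; left; apply/eqP; congr (_ * _).
apply: eq_bigr => k _; rewrite unlock; apply: eq_integral => w _.
by rewrite enorm_sqr.
Qed.

End Recursion.

(** * Step size and the final bound *)

Lemma sum_step_gt0 (R : realType) (L beta C : R) t :
  0 < L -> beta < 1 -> 0 < C -> 0 < sum_step L beta C t.
Proof.
by move=> L0 b1 C0; rewrite lt_min !divr_gt0 ?subr_gt0 ?mulr_gt0 ?sqrtr_gt0.
Qed.

Lemma sum_step_inv_le (R : realType) (L beta C : R) t :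
  (sum_step L beta C t)^-1 <=
    Num.max (2 * L / (1 - beta)) (Num.sqrt t.+1%:R / C).
Proof.
by rewrite /sum_step le_max minEle; case: ifP; rewrite invf_div lexx ?orbT.
Qed.

Lemma sum_step_bound (R : realType) (L beta C s sigma G D r : R) (t : nat) :
  0 < L -> beta < 1 -> 0 < C -> 0 <= D ->
  sum_step L beta C t / (1 - beta) / 2 * (t.+1%:R * r) <=
    D + t.+1%:R * recursion_error L sigma G (sum_step L beta C t) beta s ->
  r <= 2 * D * (1 - beta) / t.+1%:R
         * Num.max (2 * L / (1 - beta)) (Num.sqrt t.+1%:R / C)
       + C / Num.sqrt t.+1%:R
         * ((L * beta ^+ 2 * ((1 - beta) * s - 1) ^+ 2 * (G ^+ 2 + sigma ^+ 2)
             + L * sigma ^+ 2 * (1 - beta) ^+ 2) / (1 - beta) ^+ 3).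
Proof.
move=> L0 b1 C0 D0.
have A0 := sum_step_gt0 t L0 b1 C0; have AV := sum_step_inv_le L beta C t.
have AC : sum_step L beta C t <= C / Num.sqrt t.+1%:R.
  by rewrite ge_min lexx orbT.
set X := _ / (1 - beta) ^+ 3.
move: A0 AV AC; set A := sum_step _ _ _ _ => A0 AV AC.
have b0 : 0 < 1 - beta by rewrite subr_gt0.
have n0 : 0 < t.+1%:R :> R by rewrite ltr0n.
have X0 : 0 <= X.
  rewrite divr_ge0 ?exprn_ge0 ?(ltW b0)// addr_ge0//.
    rewrite mulr_ge0 ?addr_ge0 ?sqr_ge0// mulr_ge0 ?sqr_ge0//.
    by rewrite mulr_ge0 ?sqr_ge0// ltW.
  by rewrite mulr_ge0 ?sqr_ge0// mulr_ge0 ?sqr_ge0// ltW.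
rewrite mulrA -ler_pdivlMl; last by rewrite !mulr_gt0 ?invr_gt0.
move=> /le_trans; apply.
(* Dividing by [A / (1 - beta) / 2] turns the recursion error into exactly [A * X]. The step then
   occurs once inverted and once linearly: the first is bounded by the maximum, the second by
   [C / sqrt (t + 1)]. *)
apply: (@le_trans _ _ (2 * D * (1 - beta) / t.+1%:R * A^-1 + A * X)).
  rewrite le_eqVlt; apply/orP; left; apply/eqP; rewrite /X /recursion_error.
  by field; rewrite !gt_eqF.
apply: lerD; last exact: ler_wpM2r.
apply: ler_wpM2l => //.
by rewrite divr_ge0 ?(ltW n0)// mulr_ge0 ?(ltW b0)// mulr_ge0.
Qed.

Theorem theorem1 (R : realType) (d : nat) (f : 'rV[R]_d -> R) (L : R)
    (d1 d2 : measure_display)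
    (Omega : measurableType d1) (Xi : measurableType d2)
    (P : probability Omega R)
    (g : 'rV[R]_d -> Xi -> 'rV[R]_d)
    (xi : {RV P >-> Xi}) (xis : nat -> {RV P >-> Xi})
    (sigma G beta s C : R) (t : nat) (x0 : 'rV[R]_d)
    (hL : 0 < L)
    (hf : smooth L f)
    (hfb : has_lbound (range f))
    (hgm : jointly_measurable g)
    (hindep : mutually_independent xis)
    (hlaw : forall k, same_law (xis k) xi)
    (hmean : unbiased xi g f)
    (hvar : variance_bounded xi g f sigma)
    (hG : forall x, enorm (gradient f x) <= G)
    (hbeta : 0 <= beta < 1)
    (hs : 0 <= s)
    (hC : 0 < C) :
  (\big[mine/+oo]_(k < t.+1)
     'E_P[(fun w => enorm (gradient f
        (sum_iter g (sum_step L beta C t) beta s x0 (fun j => xis j w) k)) ^+ 2)%R]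
   <= (2 * (f x0 - inf (range f)) * (1 - beta) / t.+1%:R
         * Num.max (2 * L / (1 - beta)) (Num.sqrt t.+1%:R / C)
       + C / Num.sqrt t.+1%:R
         * ((L * beta ^+ 2 * ((1 - beta) * s - 1) ^+ 2 * (G ^+ 2 + sigma ^+ 2)
             + L * sigma ^+ 2 * (1 - beta) ^+ 2) / (1 - beta) ^+ 3))%R%:E)%E.
Proof.
have /andP[b0 b1] := hbeta.
have b1' : 0 < 1 - beta by rewrite subr_gt0.
set alpha := sum_step L beta C t.
have alpha0 : 0 < alpha by exact: sum_step_gt0.
have hstep : 2 * L * (alpha / (1 - beta)) <= 1.
  rewrite mulrA ler_pdivrMr// mul1r mulrC -ler_pdivlMr ?mulr_gt0//.
  by rewrite ge_min lexx.
pose E (k : 'I_t.+1) := ('E_P[(fun w => enorm (gradient f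
  (sum_iter g alpha beta s x0 (fun j => xis j w) k)) ^+ 2)%R])%E.
have H : ((alpha / (1 - beta) / 2)%:E * \sum_(k < t.+1) E k <=
    (f x0 - inf (range f) + t.+1%:R *
       recursion_error L sigma G alpha beta s)%:E)%E.
  exact: (sum_expected_gradient hL hf hfb hgm hindep hlaw hmean hvar hG).
rewrite -/(\big[mine/+oo%E]_(k < t.+1) E k).
set M := \big[mine/+oo%E]_(k < t.+1) E k.
have ME k : (M <= E k)%E by exact: bigmin_le.
have {}H : ((alpha / (1 - beta) / 2)%:E * \sum_(k < t.+1) M <=
    (f x0 - inf (range f) + t.+1%:R *
       recursion_error L sigma G alpha beta s)%:E)%E.
  apply: le_trans H; apply: lee_wpmul2l; last by apply: lee_sum => k _.
  by rewrite lee_fin !divr_ge0// ltW.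
(* The minimum lives in the extended reals: [-oo] is trivial, and [+oo] would make the left side of
   [H] infinite against a finite right side. *)
move: M {ME} H => [r| |] H; last by rewrite leNye.
- rewrite lee_fin; apply: sum_step_bound => //.
    by rewrite subr_ge0 ge_inf//; exists x0.
  by move: H; rewrite sumEFin sumr_const card_ord -EFinM lee_fin -[r *+ _]mulr_natl.
- move: H; rewrite big_ord_recl addye; last first.
    by rewrite gt_eqF// (lt_le_trans ltNy0)// sume_ge0// => i _; exact: leey.
  by rewrite gt0_muley ?lte_fin ?divr_gt0// leye_eq.
Qed.
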